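(* Let $\mathfrak{X}$ be a saturated fusion action system of a finite $p$-group $S$ on a finite set $X$, with underlying fusion system $\mathcal{F}=\mathcal{F}^{\mathfrak{X}}$, and let $\mathcal{L}^{\mathfrak{X}}$ be a linking action system associated to $\mathfrak{X}$, with structure functors $\delta:\mathcal{T}_S^{cX}\to\mathcal{L}^{\mathfrak{X}}$ and $\pi:\mathcal{L}^{\mathfrak{X}}\to\mathfrak{X}^{cX}$. Then the composite $\mathcal{L}^{\mathfrak{X}}\to\mathfrak{X}\to\mathcal{F}$, together with $\delta$, gives $\mathcal{L}^{\mathfrak{X}}$ the structure of a transporter system associated to $\mathcal{F}$.
   Context: Let $p$ be a prime, $S$ a finite $p$-group, and $X$ a finite set with a left $S$-action; $\Sigma_X$ is the symmetric group on $X$, $\ell_s\in\Sigma_X$ is the permutation $x\mapsto s\cdot x$, and $c_s$ is conjugation $h\mapsto shs^{-1}$. $\mathrm{Inj}(P,Q)$ is the set of injective homomorphisms $P\to Q$. A pair $(\varphi,\sigma)\in\mathrm{Inj}(P,Q)\times\Sigma_X$ ($P,Q\le S$) is intertwined if $\sigma\ell_p\sigma^{-1}=\ell_{\varphi(p)}$ for all $p\in P$. Let $\mathfrak{U}$ be the category whose objects are all subgroups of $S$, whose morphisms $P\to Q$ are the intertwined pairs, composed componentwise. Let $\mathfrak{X}_S\subseteq\mathfrak{U}$ have the same objects and morphisms $P\to Q$ the pairs $(c_s|_P,\ell_s)$ with $s\in S$, $sPs^{-1}\le Q$. A fusion action system of $S$ on $X$ is a category $\mathfrak{X}$ with $\mathfrak{X}_S\subseteq\mathfrak{X}\subseteq\mathfrak{U}$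 such that every morphism of $\mathfrak{X}$ factors as an isomorphism of $\mathfrak{X}$ followed by an inclusion $(\mathrm{incl},\mathrm{id}_X)$. Write $\mathfrak{X}(P)=\mathfrak{X}(P,P)$ and $\mathfrak{X}(P,Q)_{\mathrm{iso}}$ for the isomorphisms. The underlying fusion system $\mathcal{F}^{\mathfrak{X}}$ has the subgroups of $S$ as objects and $\mathcal{F}^{\mathfrak{X}}(P,Q)=\{\varphi : \exists\sigma,\ (\varphi,\sigma)\in\mathfrak{X}(P,Q)\}$; two subgroups are conjugate if they are isomorphic in $\mathcal{F}^{\mathfrak{X}}$. Let $C=\{s\in S:\ell_s=\mathrm{id}_X\}$, $N_S(P;X)=N_S(P)\cap C$, $Z_S(P;X)=Z_S(P)\cap C$. A subgroup $P\le S$ is fully normalized (resp. fully centralized, fully $X$-normalized, fully $X$-centralized) if $|N_S(P)|\ge|N_S(Q)|$ (resp. the same inequality for $Z_S(-)$, $N_S(-;X)$, $Z_S(-;X)$) for all $Q$ conjugate to $P$. Put $\mathrm{Aut}_S(P)=\{c_s|_P:s\in N_S(P)\}$, $\mathrm{Aut}_S(P;X)=\{(c_s|_P,\ell_s):s\in N_S(P)\}$, $\Sigma_{\mathfrak{X}}(P)=\{\sigma:\exists\varphi,(\varphi,\sigma)\in\mathfrak{X}(P)\}$, $\Sigma^S_{\mathfrak{X}}(P)=\{\ell_s:s\in N_S(P)\}$, $\mathcal{F}^{\mathfrak{X}}(P)_0=\{\varphi:(\varphi,\mathrm{id}_X)\in\mathfrak{X}(P)\}$, $\mathcal{F}_S(P)_0=\{c_s|_P:s\in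 N_S(P;X)\}$, $\Sigma_{\mathfrak{X}}(P)_0=\{\sigma:(\mathrm{id}_P,\sigma)\in\mathfrak{X}(P)\}$, $\Sigma^S_{\mathfrak{X}}(P)_0=\{\ell_s:s\in Z_S(P)\}$. The extender of $(\varphi,\sigma)\in\mathfrak{X}(P,Q)_{\mathrm{iso}}$ is $N_{(\varphi,\sigma)}=\{n\in N_S(P):(\varphi c_n\varphi^{-1},\sigma\ell_n\sigma^{-1})\in\mathrm{Aut}_S(Q;X)\}$. $\mathfrak{X}$ is saturated if: (1) for every $P\le S$, fully normalized implies fully $X$-normalized and fully centralized, and each of fully $X$-normalized and fully centralized implies fully $X$-centralized; (2) if $P$ is fully normalized then $\mathrm{Aut}_S(P)\in\mathrm{Syl}_p(\mathcal{F}^{\mathfrak{X}}(P))$, $\mathrm{Aut}_S(P;X)\in\mathrm{Syl}_p(\mathfrak{X}(P))$ and $\Sigma^S_{\mathfrak{X}}(P)\in\mathrm{Syl}_p(\Sigma_{\mathfrak{X}}(P))$; (3) if $P$ is fully $X$-normalized then $\mathcal{F}_S(P)_0\in\mathrm{Syl}_p(\mathcal{F}^{\mathfrak{X}}(P)_0)$; (4) if $P$ is fully centralized then $\Sigma^S_{\mathfrak{X}}(P)_0\in\mathrm{Syl}_p(\Sigma_{\mathfrak{X}}(P)_0)$; (5) if $Q$ is fully $X$-centralized and $(\varphi,\sigma)\in\mathfrak{X}(P,Q)_{\mathrm{iso}}$, there is $(\widetilde\varphi,\sigma)\in\mathfrak{X}(N_{(\varphi,\sigma)},S)$ with $\widetilde\varphi|_P=\varphi$.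 $P\le S$ is $X$-centric if $Z(Q)\cap C=Z_S(Q;X)$ for all $Q$ conjugate to $P$; put $Z(P;X)=Z(P)\cap C$. For a set $\mathcal{H}$ of subgroups of $S$, $\mathcal{T}_S^{\mathcal{H}}(S)$ is the category with object set $\mathcal{H}$ and morphisms $N_S(P,Q)=\{s\in S:sPs^{-1}\le Q\}$, composed by multiplication; $\mathcal{T}_S^{cX}$ is the case of $X$-centric subgroups. $\mathfrak{X}^{cX}$ is the full subcategory of $\mathfrak{X}$ on the $X$-centric subgroups. An ($X$-centric) linking action system associated to $\mathfrak{X}$ is a category $\mathcal{L}^{\mathfrak{X}}$ whose objects are the $X$-centric subgroups of $S$, with functors $\mathcal{T}_S^{cX}\xrightarrow{\delta}\mathcal{L}^{\mathfrak{X}}\xrightarrow{\pi}\mathfrak{X}^{cX}$; write $\widehat s=\delta_{P,Q}(s)$ and $\pi(\mathfrak{g})=(c_{\mathfrak{g}},\ell_{\mathfrak{g}})$. It satisfies: (A) $\delta,\pi$ are the identity on objects, $\delta$ is injective and $\pi$ surjective on morphisms, $Z(P;X)$ acts (via $\delta$) freely on the right on $\mathcal{L}^{\mathfrak{X}}(P,Q)$, and $\pi_{P,Q}$ is the orbit map of this action; (B) for $p\in P$, $c_{\widehat p}=c_p$ and $\ell_{\widehat p}=\ell_p$; (C) for $\mathfrak{g}\in\mathcal{L}^{\mathfrak{X}}(P,Q)$ and $p\in P$, $\widehat{c_{\mathfrak{g}}(p)}\circ\mathfrak{g}=\mathfrak{g}\circ\widehat p$. An (abstract) transporter system associated to a fusion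 system $\mathcal{F}$ on $S$ is a category $\mathcal{T}$ whose objects are a set of subgroups of $S$ closed under $\mathcal{F}$-conjugacy and overgroups, with functors $\mathcal{T}_S^{\mathrm{Ob}(\mathcal{T})}(S)\xrightarrow{\delta}\mathcal{T}\xrightarrow{\pi}\mathcal{F}$ (write $\widehat s=\delta_{P,Q}(s)$, $c_{\mathfrak{g}}=\pi_{P,Q}(\mathfrak{g})$) such that: (A1) on objects $\delta$ is the identity and $\pi$ the inclusion; (A2) with $E(P)=\ker[\mathcal{T}(P)\to\mathcal{F}(P)]$, for all objects $P,Q$ the group $E(P)$ acts right-freely and $E(Q)$ left-freely on $\mathcal{T}(P,Q)$, and $\pi_{P,Q}:\mathcal{T}(P,Q)\to\mathcal{F}(P,Q)$ is the orbit map of the $E(P)$-action; (B) $\delta$ is injective on morphisms and $c_{\widehat s}=c_s$ for all $s\in N_S(P,Q)$; (C) $\widehat{c_{\mathfrak{g}}(p)}\circ\mathfrak{g}=\mathfrak{g}\circ\widehat p$ for all $\mathfrak{g}\in\mathcal{T}(P,Q)$, $p\in P$; (I) $\delta_{S,S}(S)\in\mathrm{Syl}_p(\mathcal{T}(S))$; (II) for every isomorphism $\mathfrak{g}\in\mathcal{T}(P,Q)$ and $P\trianglelefteq\widetilde P\le S$, $Q\trianglelefteq\widetilde Q\le S$ with $\mathfrak{g}\,\delta_{P,P}(\widetilde P)\,\mathfrak{g}^{-1}\le\delta_{Q,Q}(\widetilde Q)$, there is $\widetilde{\mathfrak{g}}\in\mathcal{T}(\widetilde P,\widetilde Q)$ with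 $\widetilde{\mathfrak{g}}\circ\delta_{P,\widetilde P}(1)=\delta_{Q,\widetilde Q}(1)\circ\mathfrak{g}$. *)

(* Defs.v *)
From HB Require Import structures.
From mathcomp Require Import all_boot all_fingroup all_solvable.

Set Implicit Arguments.
Unset Strict Implicit.
Unset Printing Implicit Defensive.

Import GroupScope.

(* The finite p-group S is a whole finGroupType, so its subgroups are the
   elements of {group S}, and N_S(P), Z_S(P) are 'N(P), 'C(P).  A homomorphism
   P -> Q is encoded as a finite function S -> S taking the value 1 outside P;
   with this convention extensional equality on P is Leibniz equality, and the
   composite of homomorphisms is the composite of the underlying functions. *)

Section Homs.
Variable S : finGroupType.
Implicit Types (P Q R : {group S}) (f g : {ffun S -> S}) (s : S).

Definition restr (P : {set S}) (f : S -> S) : {ffun S -> S} :=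
  [ffun x => if x \in P then f x else 1].

Definition fcomp g f : {ffun S -> S} := [ffun x => g (f x)].

(* For P contained in Q this is also the inclusion of P in Q. *)
Definition idf P := restr P id.

(* MathComp's own conjugation x ^ s is s^-1 * x * s, the opposite convention. *)
Definition cj P s := restr P (fun x => s * x * s^-1).

Definition Inj P Q : {set {ffun S -> S}} :=
  [set f : {ffun S -> S} | [&& morphic P f, dinjectiveb f P, f @: P \subset Q
             & [forall (x | x \notin P), f x == 1]]].

(* For f injective on P, the inverse of f as a homomorphism f(P) -> P. *)
Definition finvh P f : {ffun S -> S} :=
  [ffun y => odflt 1 [pick x in P | f x == y]].

(* N_S(P, Q) *)
Definition transp P Q : {set S} := [set s | [forall x in P, s * x * s^-1 \in Q]].

Lemma restrE P f x : x \in P -> restr P f x = f x.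
Proof. by rewrite ffunE => ->. Qed.

Lemma InjP P Q f : reflect
  [/\ {in P &, {morph f : x y / x * y}}, {in P &, injective f},
      forall x, x \in P -> f x \in Q & forall x, x \notin P -> f x = 1]
  (f \in Inj P Q).
Proof.
rewrite inE; apply: (iffP and4P) => -[h1 h2 h3 h4]; split.
- by move=> x y Px Py; apply: (morphicP h1).
- exact/dinjectiveP.
- by move=> x Px; apply: (subsetP h3); apply: imset_f.
- by move=> x nPx; apply/eqP; have /forallP/(_ x)/implyP := h4; apply.
- by apply/morphicP.
- exact/dinjectiveP.
- by apply/subsetP=> _ /imsetP[x Px ->]; apply: h3.
- by apply/forallP=> x; apply/implyP=> nPx; apply/eqP/h4.
Qed.

Lemma Inj_in P Q f x : f \in Inj P Q -> x \in P -> f x \in Q.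
Proof. by case/InjP=> _ _ h _; apply: h. Qed.

Lemma Inj_in_total P Q f x : f \in Inj P Q -> f x \in Q.
Proof.
case/InjP=> _ _ h1 h2; case: (boolP (x \in P)); first exact: h1.
by move/h2->; apply: group1.
Qed.

Lemma transpP P Q s :
  reflect (forall x, x \in P -> s * x * s^-1 \in Q) (s \in transp P Q).
Proof. by rewrite inE; apply: (iffP forall_inP). Qed.

Lemma transp1 P Q : P \subset Q -> 1 \in transp P Q.
Proof.
by move=> /subsetP sPQ; apply/transpP=> x /sPQ; rewrite mul1g invg1 mulg1.
Qed.

Lemma transpM P Q R s t :
  s \in transp P Q -> t \in transp Q R -> t * s \in transp P R.
Proof.
move=> /transpP hs /transpP ht; apply/transpP=> x /hs/ht.
by rewrite invMg !mulgA.
Qed.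

Lemma transp_norm P s : s \in 'N(P) -> s \in transp P P.
Proof.
move=> nPs; apply/transpP=> x Px.
have -> : s * x * s^-1 = x ^ s^-1 by rewrite conjgE invgK mulgA.
by rewrite memJ_norm // groupV.
Qed.

Lemma transp_in P s : s \in P -> s \in transp P P.
Proof. by move=> Ps; apply/transp_norm/(subsetP (normG P)). Qed.

Lemma cj1 P : cj P 1 = idf P.
Proof. by apply/ffunP=> x; rewrite !ffunE mul1g invg1 mulg1. Qed.

Lemma fcompA f g h : fcomp h (fcomp g f) = fcomp (fcomp h g) f.
Proof. by apply/ffunP=> x; rewrite !ffunE. Qed.

Lemma fcomp_idl P Q f : f \in Inj P Q -> fcomp (idf Q) f = f.
Proof.
by move=> fi; apply/ffunP=> x; rewrite !ffunE (Inj_in_total x fi).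
Qed.

Lemma fcomp_idr P Q f : f \in Inj P Q -> fcomp f (idf P) = f.
Proof.
move=> fi; apply/ffunP=> x; rewrite !ffunE; case: ifPn => // nPx.
case/InjP: fi => fM _ _ /(_ x nPx) ->.
by apply: (mulgI (f 1)); rewrite -fM ?group1 // !mulg1.
Qed.

(* The set of automorphisms of P in A, as permutations of S supported on P.
   MathComp multiplies permutations from left to right, so this is the opposite
   of the group of automorphisms under composition; the two have the same
   subgroups and the same Sylow subgroups. *)
Definition autperm P (A : {set {ffun S -> S}}) : {set {perm S}} :=
  [set u in Aut P | restr P u \in A].

Definition Aut_S P : {set {ffun S -> S}} := [set cj P s | s in 'N(P)].

End Homs.

Section FusionSystems.
Variable S : finGroupType.
Implicit Types P Q R : {group S}.

Definition hom_iso (M : {group S} -> {group S} -> {set {ffun S -> S}}) P Q :=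
  [set f in M P Q |
    [exists g in M Q P, (fcomp g f == idf P) && (fcomp f g == idf Q)]].

Record fusion_system := FusionSystem {
  fus :> {group S} -> {group S} -> {set {ffun S -> S}};
  fus_sub : forall P Q, fus P Q \subset Inj P Q;
  fus_cj : forall P Q s, s \in transp P Q -> cj P s \in fus P Q;
  fus_comp : forall P Q R f g,
    f \in fus P Q -> g \in fus Q R -> fcomp g f \in fus P R;
  fus_fact : forall P Q f, f \in fus P Q ->
    exists R f', [/\ R \subset Q, f' \in hom_iso fus P R
                   & f = fcomp (idf R) f'] }.

Variable F : fusion_system.

Definition fus_conj P Q : bool := [exists f, f \in hom_iso F P Q].

Definition fully (D : {group S} -> {set S}) P : Prop :=
  forall Q, fus_conj P Q -> #|D Q| <= #|D P|.

Lemma fus_id P : idf P \in F P P.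
Proof. by rewrite -cj1; apply/fus_cj/transp1. Qed.

End FusionSystems.

Record left_action (S : finGroupType) (X : finType) := LeftAction {
  lact :> S -> X -> X;
  lact1 : forall x, lact 1 x = x;
  lactM : forall s t x, lact (s * t) x = lact s (lact t x) }.

Section FusionActionSystems.
Variables (S : finGroupType) (X : finType) (a : left_action S X).
Implicit Types (P Q R : {group S}) (s : S) (u v : {ffun S -> S} * {perm X}).

Lemma lact_inj s : injective (lact a s).
Proof.
by move=> x y exy; rewrite -(lact1 a x) -(lact1 a y) -(mulVg s) !lactM exy.
Qed.

Definition ell s : {perm X} := perm (@lact_inj s).

Lemma ell1 : ell 1 = 1.
Proof. by apply/permP=> x; rewrite permE perm1 lact1. Qed.

Lemma ellM s t : ell (s * t) = ell t * ell s.
Proof. by apply/permP=> x; rewrite permM !permE lactM. Qed.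

(* As MathComp multiplies permutations from left to right, the composite
   "u.2 followed by v.2" is u.2 * v.2, and t ^ s is the composite
   s o t o s^-1. *)
Definition pair_comp v u : {ffun S -> S} * {perm X} :=
  (fcomp v.1 u.1, (u.2 * v.2)%g).

Definition pid P : {ffun S -> S} * {perm X} := (idf P, 1%g).

Definition intertwined P Q : {set {ffun S -> S} * {perm X}} :=
  [set u | (u.1 \in Inj P Q) && [forall q in P, ell q ^ u.2 == ell (u.1 q)]].

Definition pair_iso (M : {group S} -> {group S} ->
                         {set {ffun S -> S} * {perm X}}) P Q :=
  [set u in M P Q |
    [exists v in M Q P, (pair_comp v u == pid P) && (pair_comp u v == pid Q)]].

(* Identities and inclusions are the pairs (c_1|_P, l_1). *)
Record fusion_action_system := FusionActionSystem {
  fas :> {group S} -> {group S} -> {set {ffun S -> S} * {perm X}};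
  fas_sub : forall P Q, fas P Q \subset intertwined P Q;
  fas_cj : forall P Q s, s \in transp P Q -> (cj P s, ell s) \in fas P Q;
  fas_comp : forall P Q R u v,
    u \in fas P Q -> v \in fas Q R -> pair_comp v u \in fas P R;
  fas_fact : forall P Q u, u \in fas P Q ->
    exists R u', [/\ R \subset Q, u' \in pair_iso fas P R
                   & u = pair_comp (pid R) u'] }.

Lemma pcompA u v w : pair_comp w (pair_comp v u) = pair_comp (pair_comp w v) u.
Proof. by rewrite /pair_comp /= fcompA mulgA. Qed.

Section Underlying.
Variable XX : fusion_action_system.

Lemma fas_id P : pid P \in XX P P.
Proof. by rewrite /pid -cj1 -ell1; apply/fas_cj/transp1. Qed.

Lemma fas_Inj P Q u : u \in XX P Q -> u.1 \in Inj P Q.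
Proof. by move/(subsetP (fas_sub XX P Q)); rewrite inE => /andP[]. Qed.

Definition undF P Q : {set {ffun S -> S}} := [set u.1 | u in XX P Q].

Lemma undF_sub P Q : undF P Q \subset Inj P Q.
Proof. by apply/subsetP=> _ /imsetP[u uX ->]; apply: fas_Inj. Qed.

Lemma undF_cj P Q s : s \in transp P Q -> cj P s \in undF P Q.
Proof. by move/(fas_cj XX)=> h; apply/imsetP; exists (cj P s, ell s). Qed.

Lemma undF_comp P Q R f g :
  f \in undF P Q -> g \in undF Q R -> fcomp g f \in undF P R.
Proof.
move=> /imsetP[u uX ->] /imsetP[v vX ->].
by apply/imsetP; exists (pair_comp v u) => //; apply: fas_comp uX vX.
Qed.

Lemma undF_fact P Q f : f \in undF P Q ->
  exists R f', [/\ R \subset Q, f' \in hom_iso undF P R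
                 & f = fcomp (idf R) f'].
Proof.
move=> /imsetP[u /fas_fact[R [u' [sRQ u'i ->]]] ->].
exists R, u'.1; split=> //.
move: u'i; rewrite !inE => /andP[u'X /exists_inP[v vX /andP[/eqP e1 /eqP e2]]].
rewrite imset_f //=; apply/exists_inP; exists v.1; first exact: imset_f.
by case: e1 => ->; case: e2 => ->; rewrite !eqxx.
Qed.

Definition und : fusion_system S :=
  FusionSystem undF_sub undF_cj undF_comp undF_fact.

End Underlying.

Definition xker : {set S} := [set s | ell s == 1].

Section Saturation.
Variables (p : nat) (XX : fusion_action_system).

Definition NX P : {set S} := 'N(P) :&: xker.
Definition ZX P : {set S} := 'C(P) :&: xker.

Definition fully_normalized := fully (und XX) (fun P => 'N(P)).
Definition fully_centralized := fully (und XX) (fun P => 'C(P)).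
Definition fully_Xnormalized := fully (und XX) NX.
Definition fully_Xcentralized := fully (und XX) ZX.

Definition Aut_SX P : {set {ffun S -> S} * {perm X}} :=
  [set (cj P s, ell s) | s in 'N(P)].

Definition autpair P (A : {set {ffun S -> S} * {perm X}}) :
    {set {perm S} * {perm X}} :=
  [set w | (w.1 \in Aut P) && ((restr P w.1, w.2) \in A)].

Definition Sigma P : {set {perm X}} := [set u.2 | u in XX P P].
Definition Sigma_S P : {set {perm X}} := [set ell s | s in 'N(P)].

Definition FX0 P : {set {ffun S -> S}} := [set f | (f, 1) \in XX P P].
Definition FS0 P : {set {ffun S -> S}} := [set cj P s | s in NX P].

Definition Sigma0 P : {set {perm X}} := [set t | (idf P, t) \in XX P P].
Definition Sigma_S0 P : {set {perm X}} := [set ell s | s in 'C(P)].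

Definition extender P Q u : {set S} :=
  [set n in 'N(P) | (fcomp u.1 (fcomp (cj P n) (finvh P u.1)), ell n ^ u.2)
                    \in Aut_SX Q].

(* In sat5, the extender of an isomorphism is already a subgroup (lemma
   gen_extender below); <<_>> only packages it as an element of {group S}. *)
Record saturated : Prop := Saturated {
  sat1 : forall P,
    [/\ fully_normalized P -> fully_Xnormalized P /\ fully_centralized P,
        fully_Xnormalized P -> fully_Xcentralized P
      & fully_centralized P -> fully_Xcentralized P];
  sat2 : forall P, fully_normalized P ->
    [/\ p.-Sylow(autperm P (und XX P P)) (autperm P (Aut_S P)),
        p.-Sylow(autpair P (XX P P)) (autpair P (Aut_SX P))
      & p.-Sylow(Sigma P) (Sigma_S P)];
  sat3 : forall P, fully_Xnormalized P ->
    p.-Sylow(autperm P (FX0 P)) (autperm P (FS0 P));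
  sat4 : forall P, fully_centralized P ->
    p.-Sylow(Sigma0 P) (Sigma_S0 P);
  sat5 : forall P Q u, fully_Xcentralized Q -> u \in pair_iso XX P Q ->
    exists2 f, (f, u.2) \in XX <<extender P Q u>>%G [set: S]%G
             & restr P f = u.1 }.

Definition xcentrics : {set {group S}} :=
  [set P | [forall Q : {group S},
              fus_conj (und XX) P Q ==> ('Z(Q) :&: xker == ZX Q)]].

Lemma extender_group_set P Q u : u \in pair_iso XX P Q ->
  group_set (extender P Q u).
Proof.
rewrite inE => /andP[uX /exists_inP[v vX /andP[/eqP[e1 _] /eqP[e2 _]]]].
have [fM fi fin _] := InjP _ _ _ (fas_Inj uX).
have [_ _ gin _] := InjP _ _ _ (fas_Inj vX).
have fK x : x \in P -> finvh P u.1 (u.1 x) = x.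
  move=> Px; rewrite ffunE; case: pickP => [y /andP[Py /eqP ey]|] /=.
    exact: fi.
  by move/(_ x); rewrite /= Px eqxx.
have ug y : y \in Q -> u.1 (v.1 y) = y.
  by move=> Qy; move/ffunP/(_ y): e2; rewrite !ffunE Qy.
have iK y : y \in Q -> finvh P u.1 y = v.1 y.
  by move=> Qy; rewrite -{1}(ug y Qy) fK // gin.
have u1 : u.1 1 = 1 by apply: (mulgI (u.1 1)); rewrite -fM ?group1 // !mulg1.
have jP n x : n \in 'N(P) -> x \in P -> n * x * n^-1 \in P.
  by move=> nP Px; apply: (transpP _ _ _ (transp_norm nP)).
have iN y : y \notin Q -> finvh P u.1 y = 1.
    move=> nQy; rewrite ffunE; case: pickP => //= x /andP[Px /eqP exy].
    by rewrite -exy fin in nQy.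
have extE n y : fcomp u.1 (fcomp (cj P n) (finvh P u.1)) y =
    if y \in Q then u.1 (n * v.1 y * n^-1) else 1.
  rewrite [LHS]ffunE [fcomp (cj _ _) _ _]ffunE [cj _ _ _]ffunE.
  case: (boolP (y \in Q)) => [Qy|nQy]; first by rewrite iK // gin.
  by rewrite iN // group1 mulg1 mulgV.
have extP n : reflect (n \in 'N(P) /\ exists2 m, m \in 'N(Q) &
    (forall x, x \in P -> u.1 (n * x * n^-1) = m * u.1 x * m^-1)
    /\ ell n ^ u.2 = ell m) (n \in extender P Q u).
  rewrite [X in reflect _ X]in_set; apply: (iffP andP).
    case=> nP /imsetP[m mQ [/ffunP e1' e2']].
    split=> //; exists m => //; split=> // x Px.
    by have := e1' (u.1 x); rewrite extE ffunE fin // -iK ?fin // fK.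
  case=> nP [m mQ [e1' e2']]; split=> //; apply/imsetP; exists m => //.
  congr pair => //; apply/ffunP=> y; rewrite extE ffunE.
  by case: ifPn => // Qy; rewrite e1' ?gin // ug.
apply/group_setP; split.
  apply/extP; split; first exact: group1.
  exists 1; first exact: group1.
  by rewrite ell1 conj1g; split=> // x _; rewrite invg1 !mul1g !mulg1.
move=> n1 n2 /extP[n1P [m1 m1Q [a1 b1]]] /extP[n2P [m2 m2Q [a2 b2]]].
apply/extP; split; first exact: groupM.
exists (m1 * m2); first exact: groupM.
split; last by rewrite !ellM conjMg b1 b2.
move=> x Px.
have -> : n1 * n2 * x * (n1 * n2)^-1 = n1 * (n2 * x * n2^-1) * n1^-1.
  by rewrite invMg !mulgA.
by rewrite a1 ?jP // a2 // invMg !mulgA.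
Qed.

Lemma gen_extender P Q u : u \in pair_iso XX P Q ->
  <<extender P Q u>> = extender P Q u.
Proof. by move/extender_group_set=> h; apply: (gen_set_id h). Qed.

End Saturation.
End FusionActionSystems.

(* Categories with a prescribed type of objects, and functors that are the
   identity on objects. *)
Record category (O : Type) := Category {
  hom :> O -> O -> Type;
  idc : forall P, hom P P;
  compc : forall P Q R, hom Q R -> hom P Q -> hom P R;
  compA : forall P Q R T (h : hom R T) (g : hom Q R) (f : hom P Q),
    compc h (compc g f) = compc (compc h g) f;
  comp1l : forall P Q (f : hom P Q), compc (idc Q) f = f;
  comp1r : forall P Q (f : hom P Q), compc f (idc P) = f }.

Arguments idc {O c}.
Arguments compc {O c P Q R}.

Record functor (O : Type) (C D : category O) := Functor {
  fmap :> forall P Q, C P Q -> D P Q;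
  fmap1 : forall P, fmap (@idc O C P) = @idc O D P;
  fmapM : forall P Q R (g : C Q R) (f : C P Q),
    fmap (compc g f) = compc (fmap g) (fmap f) }.

Arguments fmap {O C D} _ P Q _.

Section FunctorComposition.
Variables (O : Type) (C D E : category O) (G : functor D E) (F : functor C D).

Lemma compF_id P : G _ _ (F _ _ (@idc O C P)) = @idc O E P.
Proof. by rewrite !fmap1. Qed.

Lemma compF_comp P Q R (g : C Q R) (f : C P Q) :
  G _ _ (F _ _ (compc g f)) = compc (G _ _ (F _ _ g)) (G _ _ (F _ _ f)).
Proof. by rewrite !fmapM. Qed.

Definition compF : functor C E :=
  @Functor O C E (fun P Q f => G P Q (F P Q f)) compF_id compF_comp.

End FunctorComposition.

Definition inverse_pair (O : Type) (C : category O) (P Q : O)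
    (g : C P Q) (h : C Q P) : Prop :=
  compc h g = idc P /\ compc g h = idc Q.

Definition isoc (O : Type) (C : category O) (P Q : O) (g : C P Q) : Prop :=
  exists h : C Q P, inverse_pair g h.

(* The monoid C(P) is a finite group, of which the elements satisfying D form a
   Sylow p-subgroup. *)
Definition Sylow_end (p : nat) (O : Type) (C : category O) (P : O)
    (D : C P P -> Prop) : Prop :=
  exists (K : finGroupType) (B : {group K}) (f : K -> C P P),
    [/\ bijective f, f 1 = idc P, forall x y, f (x * y) = compc (f x) (f y),
        forall x, x \in B <-> D (f x) & p.-Sylow([set: K]) B].

Record ob (S : finGroupType) (H : {set {group S}}) := Ob {
  ob_val :> {group S};
  obP : ob_val \in H }.

Section ConcreteCategories.
Variables (S : finGroupType) (H : {set {group S}}).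
Implicit Types P Q R : ob H.

Definition trhom P Q := {s : S | s \in transp P Q}.
Definition trid P : trhom P P := exist _ 1 (transp1 (subxx P)).
Definition trcomp P Q R (t : trhom Q R) (s : trhom P Q) : trhom P R :=
  exist _ (sval t * sval s) (transpM (svalP s) (svalP t)).

Lemma trcompA P Q R T (h : trhom R T) (g : trhom Q R) (f : trhom P Q) :
  trcomp h (trcomp g f) = trcomp (trcomp h g) f.
Proof. by apply: val_inj; rewrite /= mulgA. Qed.
Lemma trcomp1l P Q (f : trhom P Q) : trcomp (trid Q) f = f.
Proof. by apply: val_inj; rewrite /= mul1g. Qed.
Lemma trcomp1r P Q (f : trhom P Q) : trcomp f (trid P) = f.
Proof. by apply: val_inj; rewrite /= mulg1. Qed.

(* T_S^H(S) *)
Definition trcat : category (ob H) := Category trcompA trcomp1l trcomp1r.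

Section Fusion.
Variable F : fusion_system S.

Definition fushom P Q := {f : {ffun S -> S} | f \in F P Q}.
Definition fusid P : fushom P P := exist _ (idf P) (fus_id F P).
Definition fushcomp P Q R (g : fushom Q R) (f : fushom P Q) : fushom P R :=
  exist _ (fcomp (sval g) (sval f)) (fus_comp (svalP f) (svalP g)).

Lemma fushom_Inj P Q (f : fushom P Q) : sval f \in Inj P Q.
Proof. exact: subsetP (fus_sub F P Q) _ (svalP f). Qed.

Lemma fushcompA P Q R T (h : fushom R T) (g : fushom Q R) (f : fushom P Q) :
  fushcomp h (fushcomp g f) = fushcomp (fushcomp h g) f.
Proof. by apply: val_inj; rewrite /= fcompA. Qed.
Lemma fushcomp1l P Q (f : fushom P Q) : fushcomp (fusid Q) f = f.
Proof. by apply: val_inj; apply: fcomp_idl (fushom_Inj f). Qed.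
Lemma fushcomp1r P Q (f : fushom P Q) : fushcomp f (fusid P) = f.
Proof. by apply: val_inj; apply: fcomp_idr (fushom_Inj f). Qed.

(* The full subcategory of F on H. *)
Definition fuscat : category (ob H) := Category fushcompA fushcomp1l fushcomp1r.

End Fusion.

Section FusionAction.
Variables (X : finType) (a : left_action S X) (XX : fusion_action_system a).

Definition fashom P Q := {u : {ffun S -> S} * {perm X} | u \in XX P Q}.
Definition fasid P : fashom P P := exist _ (pid X P) (fas_id XX P).
Definition fashcomp P Q R (v : fashom Q R) (u : fashom P Q) : fashom P R :=
  exist _ (pair_comp (sval v) (sval u)) (fas_comp (svalP u) (svalP v)).

Lemma fashcompA P Q R T (h : fashom R T) (g : fashom Q R) (f : fashom P Q) :
  fashcomp h (fashcomp g f) = fashcomp (fashcomp h g) f.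
Proof. by apply: val_inj; rewrite /= pcompA. Qed.
Lemma fashcomp1l P Q (f : fashom P Q) : fashcomp (fasid Q) f = f.
Proof.
apply: val_inj; rewrite /= /pair_comp (fcomp_idl (fas_Inj (svalP f))) mulg1.
by rewrite -surjective_pairing.
Qed.
Lemma fashcomp1r P Q (f : fashom P Q) : fashcomp f (fasid P) = f.
Proof.
apply: val_inj; rewrite /= /pair_comp (fcomp_idr (fas_Inj (svalP f))) mul1g.
by rewrite -surjective_pairing.
Qed.

(* The full subcategory of XX on H. *)
Definition fascat : category (ob H) := Category fashcompA fashcomp1l fashcomp1r.

Definition forget_hom P Q (u : fascat P Q) : fuscat (und XX) P Q :=
  exist _ (sval u).1 (imset_f fst (svalP u)).

Lemma forget_id P : forget_hom (@idc _ fascat P) = @idc _ (fuscat (und XX)) P.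
Proof. exact: val_inj. Qed.
Lemma forget_comp P Q R (g : fascat Q R) (f : fascat P Q) :
  forget_hom (compc g f) = compc (forget_hom g) (forget_hom f).
Proof. exact: val_inj. Qed.

Definition forget : functor fascat (fuscat (und XX)) :=
  @Functor _ fascat (fuscat (und XX)) forget_hom forget_id forget_comp.

End FusionAction.

Section Hat.
Variables (T : category (ob H)) (delta : functor trcat T).

(* delta_{P,P}(x) for x in P *)
Definition hat P x (Px : x \in P) : T P P :=
  delta P P (exist _ x (transp_in Px)).

(* delta_{P,P}(x) for x in N_S(P) *)
Definition hatN P x (nPx : x \in 'N(P)) : T P P :=
  delta P P (exist _ x (transp_norm nPx)).

(* delta_{P,Q}(1) for P contained in Q *)
Definition hat1 P Q (sPQ : P \subset Q) : T P Q :=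
  delta P Q (exist _ 1 (transp1 sPQ)).

End Hat.

End ConcreteCategories.

Section LinkingActionSystem.
Variables (S : finGroupType) (X : finType) (a : left_action S X).
Variables (XX : fusion_action_system a).
Local Notation H := (xcentrics XX).
Variables (L : category (ob H)).
Variables (delta : functor (trcat H) L) (pi : functor L (fascat H XX)).
Implicit Types P Q : ob H.

Definition lc P Q (g : L P Q) : {ffun S -> S} := (sval (pi P Q g)).1.
Definition lell P Q (g : L P Q) : {perm X} := (sval (pi P Q g)).2.

Lemma lc_in P Q (g : L P Q) x : x \in P -> lc g x \in Q.
Proof. exact: Inj_in (fas_Inj (svalP (pi P Q g))). Qed.

Definition ZPX P : {set S} := 'Z(P) :&: xker a.

Lemma ZPX_in P z : z \in ZPX P -> z \in P.
Proof. by rewrite inE => /andP[/(subsetP (center_sub P))]. Qed.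

Record linking_action_system : Prop := LinkingActionSystem {
  lk_delta_inj : forall P Q, injective (delta P Q);
  lk_pi_surj : forall P Q (u : fascat H XX P Q), exists g, pi P Q g = u;
  lk_free : forall P Q (g : L P Q) z (Zz : z \in ZPX P),
    compc g (hat delta (ZPX_in Zz)) = g -> z = 1;
  lk_orbit : forall P Q (g h : L P Q),
    pi P Q g = pi P Q h <->
    exists z (Zz : z \in ZPX P), h = compc g (hat delta (ZPX_in Zz));
  lk_B : forall P x (Px : x \in P),
    lc (hat delta Px) = cj P x /\ lell (hat delta Px) = ell a x;
  lk_C : forall P Q (g : L P Q) x (Px : x \in P),
    compc (hat delta (lc_in g Px)) g = compc g (hat delta Px) }.

End LinkingActionSystem.

Section TransporterSystem.
Variables (S : finGroupType) (p : nat) (F : fusion_system S).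
Variables (H : {set {group S}}) (T : category (ob H)).
Variables (delta : functor (trcat H) T) (pi : functor T (fuscat H F)).
Implicit Types P Q : ob H.

Definition tc P Q (g : T P Q) : {ffun S -> S} := sval (pi P Q g).

Lemma tc_in P Q (g : T P Q) x : x \in P -> tc g x \in Q.
Proof. exact: Inj_in (fushom_Inj (pi P Q g)). Qed.

Definition tker P (e : T P P) : Prop := pi P P e = idc P.

(* In tr_II, the overgroups of P and Q range over ob H without loss, as H is
   closed under overgroups. *)
Record transporter_system : Prop := TransporterSystem {
  tr_conj : forall P0 Q0 : {group S}, P0 \in H -> fus_conj F P0 Q0 -> Q0 \in H;
  tr_over : forall P0 Q0 : {group S}, P0 \in H -> P0 \subset Q0 -> Q0 \in H;
  (* The kernel E(P) is a group, not merely a monoid. *)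
  tr_A2_group : forall P (e : T P P), tker e -> isoc e;
  tr_A2_freer : forall P Q (g : T P Q) (e : T P P),
    tker e -> compc g e = g -> e = idc P;
  tr_A2_freel : forall P Q (g : T P Q) (e : T Q Q),
    tker e -> compc e g = g -> e = idc Q;
  tr_A2_surj : forall P Q (f : fuscat H F P Q), exists g, pi P Q g = f;
  tr_A2_orbit : forall P Q (g h : T P Q),
    pi P Q g = pi P Q h <-> exists2 e : T P P, tker e & h = compc g e;
  tr_B_inj : forall P Q, injective (delta P Q);
  tr_B : forall P Q (s : trcat H P Q), tc (delta P Q s) = cj P (sval s);
  tr_C : forall P Q (g : T P Q) x (Px : x \in P),
    compc (hat delta (tc_in g Px)) g = compc g (hat delta Px);
  tr_I : exists2 PS : ob H, PS = [set: S]%G :> {group S}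
    & Sylow_end p (fun g : T PS PS => exists s, g = delta PS PS s);
  tr_II : forall P Q P' Q' (g : T P Q) (g' : T Q P)
    (nP : P <| P') (nQ : Q <| Q'),
    inverse_pair g g' ->
    (forall n (P'n : n \in P'), exists m (Q'm : m \in Q'),
       compc (compc g (hatN delta (subsetP (normal_norm nP) n P'n))) g'
       = hatN delta (subsetP (normal_norm nQ) m Q'm)) ->
    exists gt : T P' Q',
      compc gt (hat1 delta (normal_sub nP)) = compc (hat1 delta (normal_sub nQ)) g
  }.

End TransporterSystem.

(* Main.v *)
From HB Require Import structures.
Require Import Defs.
From mathcomp Require Import all_boot all_fingroup all_solvable.
From Stdlib Require Import IndefiniteDescription.

(** Everything rests on two cancellation properties of a linking action system.
    Two morphisms of L with the same image under pi differ by some hat z with z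
    in Z(P;X), and hat z is trivial as soon as it fixes a morphism.  As the
    morphisms of the fusion action system are monomorphisms, so are those of L
    ([link_mono]).  On the other side, if hat t fixes g : P -> Q and t acts
    trivially on X, then t centralizes the image R of P, so t lies in R because
    P is X-centric; pulling t back through g moves it to the source, where it
    must be trivial ([link_cent1]).

    The freeness of the two actions of E(P) and E(Q) follows at once, and two
    morphisms P -> Q inducing the same homomorphism differ by an element of E(P)
    because X-morphisms corestrict to isomorphisms onto their images
    ([link_faithful]).

    For the two remaining axioms the permutation attached to delta(s) has to be
    known for every s in N_S(P,Q), while it is only prescribed for s in P: the
    inclusion P -> S may be sent by pi to (incl, tau_P) with tau_P nontrivial.
    However (id, tau_P) is an automorphism of P in the fusion action system, and
    conjugating pi by these automorphisms gives a new linking structure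
    ([untwisted_linking]) with pi(delta(s)) = (c_s, l_s) throughout
    ([untwisted_delta]).  The two axioms involve L and delta only, so this
    structure may be used instead.

    Axiom (I): L(S) has |X(S)| |Z(S;X)| elements and S is an extension of
    Aut_S(S;X) by Z(S;X), so the index of S in L(S) is the index of Aut_S(S;X)
    in X(S), prime to p since S is fully normalized ([link_Sylow]).

    Axiom (II): pi(g) extends to P' by saturation, since an X-centric subgroup
    is fully X-centralized and P' lies in the extender; lift the extension to L,
    correct the lift by an element of Z(P;X) so that it extends g, and use
    [link_cent1] to see that it takes P' into Q' ([link_extend]). *)

Set Implicit Arguments.
Unset Strict Implicit.
Unset Printing Implicit Defensive.

Import GroupScope.

(** * Fusion systems and fusion action systems *)

Section Fusion.
Variables (S : finGroupType) (F : fusion_system S).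
Implicit Types P Q R : {group S}.

Lemma fus_conj_trans P Q R : fus_conj F P Q -> fus_conj F Q R -> fus_conj F P R.
Proof.
case/existsP=> f /setIdP[fF /exists_inP[f' f'F /andP[/eqP f'f /eqP ff']]].
case/existsP=> g /setIdP[gF /exists_inP[g' g'F /andP[/eqP g'g /eqP gg']]].
have fI := subsetP (fus_sub F P Q) f fF.
have g'I := subsetP (fus_sub F R Q) g' g'F.
apply/existsP; exists (fcomp g f); rewrite inE (fus_comp fF gF).
apply/exists_inP; exists (fcomp f' g'); first exact: fus_comp g'F f'F.
apply/andP; split; apply/eqP.
  by rewrite -fcompA (fcompA f) g'g (fcomp_idl fI).
by rewrite -fcompA (fcompA g') ff' (fcomp_idl g'I).
Qed.

End Fusion.

Section FusionAction.
Variables (S : finGroupType) (X : finType) (a : left_action S X).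
Variable XX : fusion_action_system a.
Implicit Types P Q R : {group S}.
Implicit Types u v : {ffun S -> S} * {perm X}.

Lemma pair_comp_idl P Q u : u \in XX P Q -> pair_comp (pid X Q) u = u.
Proof.
by case: u => f t uX; rewrite /pair_comp /= (fcomp_idl (fas_Inj uX)) mulg1.
Qed.

Lemma fas_incl P Q : P \subset Q -> pid X P \in XX P Q.
Proof. by move=> sPQ; rewrite /pid -cj1 -(ell1 a) fas_cj // transp1. Qed.

(** The factorization axiom in its usable form; R is the image of u. *)
Lemma fas_onto P Q u : u \in XX P Q ->
  exists2 R : {group S}, R \subset Q & u \in pair_iso XX P R.
Proof.
case/fas_fact=> R [v [sRQ vi ->]]; exists R => //.
have vX : v \in XX P R by case/setIdP: vi.
by rewrite (pair_comp_idl vX).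
Qed.

Lemma pair_iso_inv P Q u : u \in pair_iso XX P Q ->
  exists v, [/\ u \in XX P Q, v \in XX Q P,
                pair_comp v u = pid X P & pair_comp u v = pid X Q].
Proof.
by case/setIdP=> uX /exists_inP[v vX /andP[/eqP e1 /eqP e2]]; exists v.
Qed.

Lemma inverse_morph P Q u v : u \in XX P Q -> v \in XX Q P ->
    pair_comp u v = pid X Q ->
  {in Q, forall y, v.1 y \in P /\ u.1 (v.1 y) = y}.
Proof.
move=> uX vX [e _] y Qy; split; first exact: Inj_in (fas_Inj vX) Qy.
by move/ffunP/(_ y): e; rewrite !ffunE Qy.
Qed.

Lemma pair_iso_onto P Q u y : u \in pair_iso XX P Q -> y \in Q ->
  exists2 x, x \in P & u.1 x = y.
Proof.
case/pair_iso_inv=> v [uX vX _ e] Qy.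
by have [] := inverse_morph uX vX e Qy; exists (v.1 y).
Qed.

Lemma pair_iso_card P Q u : u \in pair_iso XX P Q -> #|P| = #|Q|.
Proof.
move=> ui; have [v [uX _ _ _]] := pair_iso_inv ui.
have [_ fi fin _] := InjP _ _ _ (fas_Inj uX).
have -> : Q = u.1 @: P :> {set S}.
  apply/setP=> y; apply/idP/imsetP => [Qy | [x Px ->]]; last exact: fin.
  by have [x Px <-] := pair_iso_onto ui Qy; exists x.
by rewrite card_in_imset.
Qed.

Lemma pair_iso_conj P Q u : u \in pair_iso XX P Q -> fus_conj (und XX) P Q.
Proof.
case/pair_iso_inv=> v [uX vX [e1 _] [e2 _]].
apply/existsP; exists u.1; rewrite inE imset_f //=.
by apply/exists_inP; exists v.1; rewrite ?imset_f // e1 e2 !eqxx.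
Qed.

(** An endomorphism is onto, for reasons of cardinality. *)
Lemma fas_endo P u : u \in XX P P -> u \in pair_iso XX P P.
Proof.
move=> uX; have [R sRP ui] := fas_onto uX.
suff eRP : R = P by rewrite eRP in ui.
by apply/val_inj/eqP; rewrite eqEcard sRP (pair_iso_card ui) leqnn.
Qed.

Lemma fas_ell P Q u x : u \in XX P Q -> x \in P ->
  ell a x ^ u.2 = ell a (u.1 x).
Proof.
move/(subsetP (fas_sub XX P Q)); rewrite inE => /andP[_ /forall_inP h] Px.
exact/eqP/h.
Qed.

(** The factorization axiom only corestricts u to its image, from which the
    inclusion into R is then available. *)
Lemma fas_corestr P Q R u : u \in XX P Q -> {in P, forall x, u.1 x \in R} ->
  u \in XX P R.
Proof.
move=> uX uR; have [R' _ ui] := fas_onto uX.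
have [v [uX' _ _ _]] := pair_iso_inv ui.
have sR'R : R' \subset R.
  by apply/subsetP=> y R'y; have [x Px <-] := pair_iso_onto ui R'y; apply: uR.
by rewrite -(pair_comp_idl uX') (fas_comp uX') ?fas_incl.
Qed.

Lemma fas_mono P Q R u v v' : u \in XX Q R -> v \in XX P Q -> v' \in XX P Q ->
  pair_comp u v = pair_comp u v' -> v = v'.
Proof.
case: v v' => [f s] [f' s'] uX vX v'X [ef es].
congr (_, _); last exact: mulIg es.
have [_ ui _ _] := InjP _ _ _ (fas_Inj uX).
apply/ffunP=> x; apply: ui; first exact: Inj_in_total (fas_Inj vX).
  exact: Inj_in_total (fas_Inj v'X).
by move/ffunP/(_ x): ef; rewrite !ffunE.
Qed.

Lemma xker1 x : x \in xker a -> ell a x = 1.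
Proof. by rewrite inE => /eqP. Qed.

(** Conjugating l_x by a permutation does not affect its triviality. *)
Lemma fas_xker P Q u x : u \in XX P Q -> x \in P ->
  (u.1 x \in xker a) = (x \in xker a).
Proof.
by move=> uX Px; rewrite !inE -(fas_ell uX Px) conjg_eq1.
Qed.

Lemma xcentric_cent P Q z : P \in xcentrics XX -> fus_conj (und XX) P Q ->
  z \in 'C(Q) -> z \in xker a -> z \in Q.
Proof.
rewrite inE => /forallP/(_ Q)/implyP h /h /eqP e Cz Kz.
have : z \in ZX a Q by rewrite inE Cz.
by rewrite -e => /setIP[/(subsetP (center_sub Q))].
Qed.

Lemma xcentricP P : (forall Q z, fus_conj (und XX) P Q ->
    z \in 'C(Q) -> z \in xker a -> z \in Q) -> P \in xcentrics XX.
Proof.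
move=> h; rewrite inE; apply/forallP=> Q; apply/implyP=> PQ.
apply/eqP/setP=> z; rewrite /ZX !in_setI.
case: (boolP (z \in xker a)) => Kz; rewrite ?andbF // !andbT.
by rewrite andb_idl // => /h->.
Qed.

Lemma xcentric_conj P Q : P \in xcentrics XX -> fus_conj (und XX) P Q ->
  Q \in xcentrics XX.
Proof.
move=> cP PQ; apply: xcentricP => R z QR.
exact: xcentric_cent cP (fus_conj_trans PQ QR).
Qed.

(** If f maps Q isomorphically onto Q1, an element centralizing Q1 and acting
    trivially on X centralizes the conjugate f(P) of P, hence lies in it. *)
Lemma xcentric_over P Q : P \in xcentrics XX -> P \subset Q ->
  Q \in xcentrics XX.
Proof.
move=> cP sPQ; apply: xcentricP => R z /existsP[f /setIdP[/imsetP[u uX _] _]].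
have uPX : pair_comp u (pid X P) \in XX P R.
  by apply: fas_comp (fas_incl sPQ) uX.
have [R' sR'R /pair_iso_conj PR'] := fas_onto uPX => Cz Kz.
apply: (subsetP sR'R); apply: (xcentric_cent cP PR') => //.
exact: subsetP (centS sR'R) z Cz.
Qed.

Lemma setT_xcentric : [set: S]%G \in xcentrics XX.
Proof.
apply: xcentricP => Q z /existsP[f /setIdP[/imsetP[u uX _] _]] _ _.
have [R sRQ /pair_iso_card e] := fas_onto uX.
suff -> : Q = [set: S]%G by rewrite inE.
by apply/val_inj/eqP; rewrite eqEcard subsetT e subset_leq_card.
Qed.

(** For X-centric P the groups Z_S(Q;X), for Q conjugate to P, are all
    isomorphic: each equals Z(Q;X), which isomorphisms transport. *)
Lemma xcentric_Xcentralized P : P \in xcentrics XX -> fully_Xcentralized XX P.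
Proof.
move=> cP Q PQ; have := PQ => /existsP[f].
rewrite inE => /andP[/imsetP[u uX ->{f}] /exists_inP[_ /imsetP[v vX ->]]].
case/andP=> [/eqP vu /eqP uv].
have [vM vi vin _] := InjP _ _ _ (fas_Inj vX).
have sub : ZX a Q \subset Q.
  by apply/subsetP=> z /setIP[Cz Kz]; apply: xcentric_cent cP PQ Cz Kz.
rewrite -(card_in_imset (sub_in2 (subsetP sub) vi)); apply: subset_leq_card.
apply/subsetP=> _ /imsetP[z Zz ->]; have Qz := subsetP sub z Zz.
have /setIP[Cz Kz] := Zz; rewrite inE (fas_xker vX) // Kz andbT.
apply/centP=> y Py.
have <- : v.1 (u.1 y) = y by move/ffunP/(_ y): vu; rewrite !ffunE Py.
have Quy : u.1 y \in Q by apply: Inj_in (fas_Inj uX) Py.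
by rewrite /commute -!vM // (centP Cz).
Qed.

(** Membership in the extender without the inverse of the isomorphism u. *)
Lemma mem_extender P Q u n m : u \in pair_iso XX P Q -> n \in 'N(P) ->
    m \in 'N(Q) ->
    pair_comp u (cj P n, ell a n) = pair_comp (cj Q m, ell a m) u ->
  n \in extender a P Q u.
Proof.
move=> ui nP mQ [ef es]; have [v [uX vX e1 e2]] := pair_iso_inv ui.
rewrite inE nP; apply/imsetP; exists m => //; congr (_, _); last first.
  by rewrite conjgE es mulKg.
have ufK : fcomp u.1 (finvh P u.1) = idf Q.
  apply/ffunP=> y; rewrite [LHS]ffunE [RHS]ffunE [finvh _ _ _]ffunE.
  case: pickP => [x /andP[Px /eqP <-]|] /=.
    by rewrite (Inj_in (fas_Inj uX)).
  have [uM _ _ _] := InjP _ _ _ (fas_Inj uX).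
  case: ifPn => [Qy | _ _].
    by have [x Px <-] := pair_iso_onto ui Qy; move/(_ x); rewrite /= Px eqxx.
  by apply: (mulgI (u.1 1)); rewrite -uM ?group1 // !mulg1.
rewrite fcompA ef -fcompA ufK; apply: fcomp_idr.
exact: fas_Inj (fas_cj XX (transp_norm mQ)).
Qed.

Lemma extend_iso p P Q P' u : saturated p XX -> Q \in xcentrics XX ->
    u \in pair_iso XX P Q -> P \subset P' -> P' \subset extender a P Q u ->
  exists2 w, w \in XX P' [set: S]%G & pair_comp w (pid X P) = u.
Proof.
move=> sat cQ ui sPP' sP'; have [v [uX _ _ _]] := pair_iso_inv ui.
have [f fX fr] := sat5 sat (xcentric_Xcentralized cQ) ui.
have sP'N : P' \subset <<extender a P Q u>>%G by rewrite /= (gen_extender ui).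
exists (pair_comp (f, u.2) (pid X P')).
  exact: fas_comp (fas_incl sP'N) fX.
rewrite [RHS]surjective_pairing -fr /pair_comp /= !mul1g; congr (_, _).
have [fM _ _ _] := InjP _ _ _ (fas_Inj fX).
have f1 : f 1 = 1 by apply: (mulgI (f 1)); rewrite -fM ?group1 // !mulg1.
apply/ffunP=> x; rewrite !ffunE.
by case: (boolP (x \in P)) => [/(subsetP sPP')|_]; rewrite ?group1 // => ->.
Qed.

End FusionAction.

(** * Cancellation in linking action systems *)

Section Delta.
Variables (S : finGroupType) (H : {set {group S}}) (T : category (ob H)).
Variable delta : functor (trcat H) T.
Implicit Types P Q R : ob H.

(** Membership proofs in N_S(P,Q) are irrelevant, so that all computations with
    delta reduce to computations in S. *)
Lemma delta_eq P Q (s t : trcat H P Q) : sval s = sval t ->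
  delta P Q s = delta P Q t.
Proof. by move=> est; congr (delta _ _ _); apply: val_inj. Qed.

Lemma delta_comp P Q R (t : trcat H Q R) (s : trcat H P Q) (r : trcat H P R) :
  sval r = sval t * sval s -> compc (delta Q R t) (delta P Q s) = delta P R r.
Proof. by move=> e; rewrite -fmapM; apply: delta_eq. Qed.

Lemma delta_id P (s : trcat H P P) : sval s = 1 -> delta P P s = idc P.
Proof. by move=> e; rewrite -(fmap1 delta); apply: delta_eq. Qed.

End Delta.

Section LinkingSystem.
Variables (S : finGroupType) (X : finType) (a : left_action S X).
Variable XX : fusion_action_system a.
Local Notation H := (xcentrics XX).
Variables (L : category (ob H)).
Variables (delta : functor (trcat H) L) (pi : functor L (fascat H XX)).
Hypothesis lk : linking_action_system delta pi.
Implicit Types P Q R : ob H.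

Local Notation hat := (hat delta).
Local Notation pr g := (sval (pi _ _ g)).

Lemma prM P Q R (g : L Q R) (f : L P Q) :
  pr (compc g f) = pair_comp (pr g) (pr f).
Proof. by rewrite fmapM. Qed.

Lemma pr_inj P Q (g h : L P Q) : pr g = pr h ->
  exists z (Zz : z \in ZPX P), h = compc g (hat (ZPX_in Zz)).
Proof. by move=> e; apply/(lk_orbit lk)/val_inj. Qed.

Lemma pr_surj P Q u : u \in XX P Q -> exists g : L P Q, pr g = u.
Proof.
by move=> uX; have [g e] := lk_pi_surj lk (exist _ u uX); exists g; rewrite e.
Qed.

Lemma link_free P Q (g : L P Q) x (Px : x \in P) : x \in ZPX P ->
  compc g (hat Px) = g -> x = 1.
Proof.
move=> Zx e; apply: (lk_free lk (g := g) (Zz := Zx)).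
by rewrite -[RHS]e; congr (compc _ _); apply: delta_eq.
Qed.

(** The X-morphism under g is a monomorphism, so f and f' differ by some hat z
    with z in Z(P;X), which acts freely. *)
Lemma link_mono P Q R (g : L Q R) (f f' : L P Q) :
  compc g f = compc g f' -> f = f'.
Proof.
move=> e; have /pr_inj[z [Zz ef']] : pr f = pr f'.
  have := congr1 (fun h => pr h) e; rewrite !prM.
  exact: fas_mono (svalP (pi _ _ g)) (svalP (pi _ _ f)) (svalP (pi _ _ f')).
move: e; rewrite ef' Defs.compA => /esym/(link_free Zz) z1.
by rewrite /Defs.hat delta_id ?comp1r.
Qed.

(** Since hat t fixes g, t centralizes the image R of P under g, so t lies in
    R as P is X-centric.  Then t = c_g(x) for some x in Z(P;X), and
    g o hat x = hat t o g = g forces x = 1. *)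
Lemma link_cent1 P Q (g : L P Q) t (Qt : t \in Q) :
  t \in xker a -> compc (hat Qt) g = g -> t = 1.
Proof.
move=> Kt e.
have uX := svalP (pi _ _ g); set u := pr g in uX.
have [R sRQ ui] := fas_onto uX.
have [uM uinj _ _] := InjP _ _ _ (fas_Inj uX).
have [tc _] := lk_B lk Qt.
have Ct : t \in 'C(R).
  apply/centP=> y Ry; have [x Px exy] := pair_iso_onto ui Ry.
  have Qy := subsetP sRQ y Ry.
  have tu : pair_comp (pr (hat Qt)) u = u by rewrite -prM e.
  have /ffunP/(_ x) := congr1 fst tu; rewrite ffunE exy.
  by rewrite -[LHS]/(lc pi (hat Qt) y) tc ffunE Qy => /(canRL (mulgKV _)).
have Rt := xcentric_cent (obP P) (pair_iso_conj ui) Ct Kt.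
have [x Px ext] := pair_iso_onto ui Rt.
have Zx : x \in ZPX P.
  rewrite in_setI -(fas_xker uX Px) ext Kt andbT inE Px; apply/centP=> y Py.
  apply: uinj; rewrite ?groupM // !uM // ext; apply: (centP Ct).
  by have [v [uXR _ _ _]] := pair_iso_inv ui; apply: Inj_in (fas_Inj uXR) Py.
suff x1 : x = 1.
  by rewrite -ext x1; apply: (mulgI (u.1 1)); rewrite -uM ?group1 // !mulg1.
apply: (link_free (g := g) (Px := Px) Zx).
rewrite -(lk_C lk) -[RHS]e; congr (compc _ _); apply: delta_eq.
exact: ext.
Qed.

(** Axiom (C) applied to delta(s) itself: delta(c(x) s) = delta(s x), where c is
    the homomorphism under delta(s), and delta is injective. *)
Lemma link_delta_conj P Q (s : trcat H P Q) :
  (pr (delta P Q s)).1 = cj P (sval s).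
Proof.
have [_ _ uin u1] := InjP _ _ _ (fas_Inj (svalP (pi _ _ (delta P Q s)))).
apply/ffunP=> x; rewrite [RHS]ffunE; case: ifPn => [Px|/u1 //].
have := lk_C lk (delta P Q s) Px; rewrite -!fmapM.
by move/(lk_delta_inj lk)/(congr1 sval) => /= /(canRL (mulgK _)).
Qed.

(** A lift of the inverse of pi(g) is a left inverse of g up to some hat z,
    and hat z is invertible. *)
Lemma link_iso P Q (g : L P Q) : pr g \in pair_iso XX P Q -> isoc g.
Proof.
case/pair_iso_inv=> v [_ vX e1 e2].
have [h eh] := pr_surj vX.
have [z [Zz hg]] : exists z (Zz : z \in ZPX P),
    compc h g = compc (idc P) (hat (ZPX_in Zz)).
  by apply: pr_inj; rewrite prM eh e1 fmap1.
have zV : z^-1 \in P by rewrite groupV (ZPX_in Zz).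
have h'g : compc (compc (hat zV) h) g = idc P.
  rewrite -Defs.compA hg comp1l (delta_comp _ (r := trid P)) /= ?mulVg //.
  exact: delta_id.
exists (compc (hat zV) h); split=> //.
(* A one-sided inverse is two-sided, because it is a monomorphism. *)
apply: (link_mono (g := compc (hat zV) h)).
by rewrite Defs.compA h'g comp1l comp1r.
Qed.

Lemma link_endo_iso P (e : L P P) : isoc e.
Proof. exact: link_iso (fas_endo (svalP (pi _ _ e))). Qed.

(** When g and h induce the same homomorphism, with image R, the isomorphisms
    P -> R under them differ by an X-automorphism (id_P, t) of P, which lifts
    to L. *)
Lemma link_faithful P Q (g h : L P Q) : (pr g).1 = (pr h).1 ->
  exists2 e : L P P, (pr e).1 = idf P & h = compc g e.
Proof.
move=> egh; have [R sRQ ui] := fas_onto (svalP (pi _ _ g)).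
have [v [uXR vX [vu _] [uv1 uv2]]] := pair_iso_inv ui.
have hXR : pr h \in XX P R.
  apply: fas_corestr (svalP (pi _ _ h)) _ => x Px.
  by rewrite -egh; apply: Inj_in (fas_Inj uXR) Px.
have [e0 e0E] := pr_surj (fas_comp hXR vX).
have [z [Zz hE]] : exists z (Zz : z \in ZPX P),
    h = compc (compc g e0) (hat (ZPX_in Zz)).
  apply: pr_inj; rewrite prM e0E /pair_comp /=.
  rewrite -egh vu (fcomp_idr (fas_Inj uXR)) egh -mulgA.
  have -> : v.2 * (pr g).2 = 1 by [].
  by rewrite mulg1 -surjective_pairing.
exists (compc e0 (hat (ZPX_in Zz))); last by rewrite Defs.compA.
rewrite prM e0E /pair_comp /= -egh vu /Defs.hat link_delta_conj /=.
have zP : cj P z \in Inj P P.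
  by apply: fas_Inj (fas_cj XX (transp_in (ZPX_in Zz))).
rewrite (fcomp_idl zP).
have /setIP[/setIP[_ /centP Cz] _] := Zz.
by apply/ffunP=> x; rewrite !ffunE; case: ifP => // /Cz ->; rewrite mulgK.
Qed.

(** The permutation under e is absorbed by that under g, hence is trivial; so e
    is hat z with z in Z(Q;X), and [link_cent1] applies. *)
Lemma link_freel P Q (g : L P Q) (e : L Q Q) :
  (pr e).1 = idf Q -> compc e g = g -> e = idc Q.
Proof.
move=> e1 eg.
have e2 : (pr e).2 = 1.
  have := congr1 (fun h => (pr h).2) eg; rewrite prM => /(canRL (mulKg _)).
  by rewrite mulVg.
have [z [Zz ez]] : exists z (Zz : z \in ZPX Q),
    e = compc (idc Q) (hat (ZPX_in Zz)).
  by apply: pr_inj; rewrite fmap1 [RHS]surjective_pairing e1 e2.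
have ehat : e = hat (ZPX_in Zz) by rewrite ez comp1l.
rewrite ehat; apply: delta_id; rewrite /=.
have Kz : z \in xker a by case/setIP: (Zz).
by apply: (link_cent1 (g := g) (Qt := ZPX_in Zz)) Kz _; rewrite -ehat.
Qed.

(** * Making pi compatible with inclusions *)

Definition topS : ob H := Ob (setT_xcentric XX).

Definition toS P : L P topS := hat1 delta (subsetT P : P \subset topS).

(** The discrepancy between pi and the inclusion of P in S.  As (id_P, twist P)
    is an X-automorphism of P, conjugating by these automorphisms is a change of
    pi that makes all discrepancies trivial. *)
Definition twist P : {perm X} := (pr (toS P)).2.

Lemma twistP P : (idf P, twist P) \in XX P P.
Proof.
have uX := svalP (pi _ _ (toS P)).
have e : pr (toS P) = (idf P, twist P).
  by rewrite [LHS]surjective_pairing link_delta_conj /= cj1.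
rewrite -e; apply: fas_corestr uX _ => x Px.
by rewrite e /= ffunE Px.
Qed.

Lemma twistVP P : (idf P, (twist P)^-1) \in XX P P.
Proof.
have [v [_ vX [e _] [_ e2]]] := pair_iso_inv (fas_endo (twistP P)).
have -> // : (idf P, (twist P)^-1) = v.
rewrite [v]surjective_pairing; congr (_, _).
  by rewrite -e (fcomp_idr (fas_Inj vX)).
by apply: (mulIg (twist P)); rewrite mulVg [RHS]e2.
Qed.

Definition untwist P Q (g : L P Q) : {ffun S -> S} * {perm X} :=
  ((pr g).1, (twist P)^-1 * (pr g).2 * twist Q).

Lemma untwist_in P Q (g : L P Q) : untwist g \in XX P Q.
Proof.
have gX := svalP (pi _ _ g).
have := fas_comp (fas_comp (twistVP P) gX) (twistP Q).
by rewrite /pair_comp /= (fcomp_idr (fas_Inj gX)) (fcomp_idl (fas_Inj gX)).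
Qed.

Definition untwist_hom P Q (g : L P Q) : fascat H XX P Q :=
  exist _ (untwist g) (untwist_in g).

Lemma untwist_id P : untwist_hom (idc P) = idc P.
Proof. by apply: val_inj; rewrite /= /untwist fmap1 /= mulg1 mulVg. Qed.

Lemma untwist_comp P Q R (g : L Q R) (f : L P Q) :
  untwist_hom (compc g f) = compc (untwist_hom g) (untwist_hom f).
Proof.
by apply: val_inj; rewrite /= /untwist prM /pair_comp /= !mulgA mulgK.
Qed.

Definition untwisted : functor L (fascat H XX) :=
  Functor untwist_id untwist_comp.

Lemma untwistedE P Q (g h : L P Q) :
  untwisted P Q g = untwisted P Q h <-> pi P Q g = pi P Q h.
Proof.
split=> [/(congr1 sval) [e1 /mulIg/mulgI e2] | e]; apply: val_inj.
  by rewrite [LHS]surjective_pairing [RHS]surjective_pairing e1 e2.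
by rewrite /= /untwist e.
Qed.

Lemma untwisted_linking : linking_action_system delta untwisted.
Proof.
split.
- exact: lk_delta_inj lk.
- move=> P Q [u uX].
  have [g ge] := pr_surj (fas_comp (fas_comp (twistP P) uX) (twistVP Q)).
  exists g; apply: val_inj; rewrite /= /untwist ge /pair_comp /=.
  rewrite (fcomp_idr (fas_Inj uX)) (fcomp_idl (fas_Inj uX)).
  by rewrite mulgA mulKg mulgKV -surjective_pairing.
- exact: lk_free lk.
- by move=> P Q g h; apply: iff_trans (untwistedE g h) (lk_orbit lk g h).
- move=> P x Px; have [e1 e2] := lk_B lk Px; split=> //.
  rewrite /lell /= -[(pr _).2]/(lell pi (hat Px)) e2 -mulgA -conjgE.
  by rewrite (fas_ell (twistP P) Px) ffunE Px.
- move=> P Q g x Px; rewrite -(lk_C lk); congr (compc _ _); exact: delta_eq.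
Qed.

(** Compare the two sides of incl o delta(s) = hat s o incl as morphisms P -> S:
    axiom (B) at the object S gives the permutation of hat s. *)
Lemma untwisted_delta P Q (s : trcat H P Q) :
  sval (untwisted P Q (delta P Q s)) = (cj P (sval s), ell a (sval s)).
Proof.
rewrite /= /untwist link_delta_conj; congr (_, _).
have sS : sval s \in topS by rewrite inE.
have e : compc (toS Q) (delta P Q s) = compc (hat sS) (toS P).
  by rewrite -!fmapM; apply: delta_eq; rewrite /= mul1g mulg1.
have := congr1 (fun h => (pr h).2) e; rewrite !prM /= -!/(twist _) => e2.
by rewrite -mulgA e2 mulKg; have [] := lk_B lk sS.
Qed.

End LinkingSystem.

(** * Extension of isomorphisms *)

Section Normalised.
Variables (S : finGroupType) (X : finType) (a : left_action S X).
Variable XX : fusion_action_system a.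
Local Notation H := (xcentrics XX).
Variables (L : category (ob H)).
Variables (delta : functor (trcat H) L) (pi : functor L (fascat H XX)).
Hypothesis lk : linking_action_system delta pi.
Local Notation pr g := (sval (pi _ _ g)).
Hypothesis pi_delta : forall (P Q : ob H) (s : trcat H P Q),
  pr (delta P Q s) = (cj P (sval s), ell a (sval s)).
Implicit Types P Q R : ob H.
Local Notation hat := (hat delta).
Local Notation topS := (topS XX).

Lemma pr_incl P Q (sPQ : P \subset Q) : pr (hat1 delta sPQ) = pid X P.
Proof. by rewrite pi_delta /= cj1 ell1. Qed.

Lemma incl_hat P R n (sPR : P \subset R) (nPn : n \in 'N(P)) (Rn : n \in R) :
  compc (hat1 delta sPR) (hatN delta nPn) = compc (hat Rn) (hat1 delta sPR).
Proof. by rewrite -!fmapM; apply: delta_eq; rewrite /= mul1g mulg1. Qed.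

(** The element z adjusts a lift of the extension of pi(g) so that it restricts
    to g; it lies in P, hence in P', and can be absorbed into the lift.  For
    n in P', if g conjugates hat n to hat m then the adjusted lift h1 sends n
    to m, so that h1 factors through Q'. *)
Lemma link_extend p P Q P' Q' (g : L P Q) (g' : L Q P)
    (nP : P <| P') (nQ : Q <| Q') : saturated p XX ->
    inverse_pair g g' ->
    (forall n (P'n : n \in P'), exists m (Q'm : m \in Q'),
       compc (compc g (hatN delta (subsetP (normal_norm nP) n P'n))) g'
       = hatN delta (subsetP (normal_norm nQ) m Q'm)) ->
  exists gt : L P' Q',
    compc gt (hat1 delta (normal_sub nP))
    = compc (hat1 delta (normal_sub nQ)) g.
Proof.
move=> sat [g'g gg'] conjg.
have gX := svalP (pi _ _ g); have g'X := svalP (pi _ _ g').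
have gi : pr g \in pair_iso XX P Q.
  rewrite inE gX; apply/exists_inP; exists (pr g') => //.
  by rewrite -!prM g'g gg' !fmap1 !eqxx.
have gN n (P'n : n \in P') : exists m (Q'm : m \in Q'),
    compc g (hatN delta (subsetP (normal_norm nP) n P'n))
    = compc (hatN delta (subsetP (normal_norm nQ) m Q'm)) g.
  have [m [Q'm e]] := conjg n P'n; exists m, Q'm.
  by rewrite -e -Defs.compA g'g comp1r.
have sP'N : P' \subset extender a P Q (pr g).
  apply/subsetP=> n P'n; have [m [Q'm e]] := gN n P'n.
  have nPn := subsetP (normal_norm nP) n P'n.
  have nQm := subsetP (normal_norm nQ) m Q'm.
  apply: (mem_extender gi nPn nQm).
  by have := congr1 (fun h => pr h) e; rewrite !prM !pi_delta.
have [w wX wP] := extend_iso sat (obP Q) gi (normal_sub nP) sP'N.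
have [h he] := pr_surj lk (Q := topS) wX.
have [z [Zz ez]] : exists z (Zz : z \in ZPX P),
    compc (toS delta Q) g
    = compc (compc h (hat1 delta (normal_sub nP))) (hat (ZPX_in Zz)).
  by apply: (pr_inj lk); rewrite !prM !pr_incl he wP (pair_comp_idl gX).
have P'z : z \in P' by apply: subsetP (normal_sub nP) _ (ZPX_in Zz).
pose h1 := compc h (hat P'z).
have h1E : compc h1 (hat1 delta (normal_sub nP)) = compc (toS delta Q) g.
  rewrite ez -!Defs.compA -!fmapM; congr (compc _ _); apply: delta_eq.
  by rewrite /= mul1g mulg1.
have h1Q' n : n \in P' -> (pr h1).1 n \in Q'.
  move=> P'n; have [m [Q'm e]] := gN n P'n.
  (* k is the restriction of h1 to P; it absorbs hat t, whence t = 1. *)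
  pose k := compc (toS delta Q) g.
  pose t := m^-1 * (pr h1).1 n.
  have St s : s \in topS by rewrite inE.
  have ek : compc (hat (St ((pr h1).1 n))) k = compc (hat (St m)) k.
    rewrite /k -h1E Defs.compA.
    have -> : compc (hat (St ((pr h1).1 n))) h1 = compc h1 (hat P'n).
      by rewrite -(lk_C lk); congr (compc _ _); apply: delta_eq.
    rewrite -Defs.compA -(incl_hat _ (subsetP (normal_norm nP) n P'n)).
    rewrite Defs.compA h1E.
    by rewrite -Defs.compA e !Defs.compA (incl_hat _ _ (St m)).
  have tk : compc (hat (St t)) k = k.
    transitivity (compc (hat (St m^-1)) (compc (hat (St ((pr h1).1 n))) k)).
      by rewrite Defs.compA -fmapM; congr (compc _ _); apply: delta_eq.
    rewrite ek Defs.compA -fmapM delta_id ?comp1l //=; exact: mulVg.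
  have Kt : t \in xker a.
    rewrite inE -(inj_eq (mulgI (pr k).2)) mulg1; apply/eqP.
    by have := congr1 (fun h => (pr h).2) tk; rewrite prM pi_delta.
  have t1 := link_cent1 lk Kt tk.
  by have /(canRL (mulKVg _)) := t1; rewrite mulg1 => ->.
have h1X : pr h1 \in XX P' Q' by apply: fas_corestr (svalP (pi _ _ h1)) h1Q'.
have [g0 g0E] := pr_surj lk h1X.
have [y [Zy ey]] : exists y (Zy : y \in ZPX P'),
    h1 = compc (compc (toS delta Q') g0) (hat (ZPX_in Zy)).
  by apply: (pr_inj lk); rewrite prM pr_incl g0E (pair_comp_idl h1X).
exists (compc g0 (hat (ZPX_in Zy))).
apply: (link_mono lk (g := toS delta Q')).
rewrite !Defs.compA -ey h1E -fmapM; congr (compc _ _); apply: delta_eq.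
by rewrite /= mulg1.
Qed.

End Normalised.

(** * The Sylow subgroup of L(S) *)

Section EndGroup.
Variables (O : Type) (C : category O) (P : O) (T : finType).
Variables (f : T -> C P P) (fi : C P P -> T) (inv : T -> T).
Hypotheses (fK : cancel f fi) (fiK : cancel fi f).
Hypothesis invP : forall x, compc (f (inv x)) (f x) = idc P.

(** A copy of T, on which composition in C(P) can be installed as group law. *)
Definition end_type : Type := T.
Definition end_one : end_type := fi (idc P).
Definition end_mul (x y : end_type) : end_type := fi (compc (f x) (f y)).
Definition end_inv (x : end_type) : end_type := inv x.

Lemma end_mulA : associative end_mul.
Proof. by move=> x y z; rewrite /end_mul !fiK Defs.compA. Qed.
Lemma end_mul1 : left_id end_one end_mul.
Proof. by move=> x; rewrite /end_mul fiK comp1l fK. Qed.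
Lemma end_mulV : left_inverse end_one end_inv end_mul.
Proof. by move=> x; rewrite /end_mul invP. Qed.

HB.instance Definition _ := Finite.on end_type.
HB.instance Definition _ :=
  Finite_isGroup.Build end_type end_mulA end_mul1 end_mulV.

Lemma end_group_exists : exists (K : finGroupType) (h : K -> C P P),
  [/\ bijective h, h 1 = idc P, forall x y, h (x * y) = compc (h x) (h y)
    & #|K| = #|T|].
Proof.
exists end_type, f; split=> //; first by exists fi.
  exact: fiK.
  by move=> x y; apply: fiK.
by apply: (@bij_eq_card end_type T (fun x => x)); exists (fun x => x).
Qed.

End EndGroup.

(** The enumeration f is inverted with a choice principle, since equality in
    C(P) need not be decidable. *)
Lemma end_group (O : Type) (C : category O) (P : O) (T : finType)
    (f : T -> C P P) :
    injective f -> (forall g, exists x, f x = g) ->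
    (forall g : C P P, isoc g) ->
  exists (K : finGroupType) (h : K -> C P P),
  [/\ bijective h, h 1 = idc P, forall x y, h (x * y) = compc (h x) (h y)
    & #|K| = #|T|].
Proof.
move=> finj fsurj fiso.
pose fiP g := constructive_indefinite_description _ (fsurj g).
pose fi g := sval (fiP g).
have fiK : cancel fi f by move=> g; apply: svalP (fiP g).
have fK : cancel f fi by move=> x; apply: finj; rewrite fiK.
have /fin_all_exists[inv invP] x : exists y, compc (f y) (f x) = idc P.
  by have [h [e _]] := fiso (f x); exists (fi h); rewrite fiK.
exact: (end_group_exists fK fiK invP).
Qed.

Section Top.
Variables (S : finGroupType) (X : finType) (a : left_action S X).
Variable XX : fusion_action_system a.
Local Notation G := [set: S]%G.

(** Conjugation and action by the inverse of s: permutations multiply from left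
    to right, so that this, and not s |-> (c_s, l_s), is a homomorphism.  It has
    kernel Z(S;X) and image Aut_S(S;X). *)
Definition opp_act (s : S) : {perm S} * {perm X} := (conj_aut G s, ell a s^-1).

Lemma opp_actM : {in G &, {morph opp_act : s t / s * t}}.
Proof.
move=> s t _ _; rewrite /opp_act invMg ellM.
congr (_, _); apply: conj_aut_morphM; apply: (subsetP (normG _));
  by rewrite inE.
Qed.
Canonical opp_act_morphism := Morphism opp_actM.

Lemma conj_autT s x : conj_aut G s x = x ^ s.
Proof. by rewrite conj_autE ?inE. Qed.

Lemma ker_opp_act : 'ker opp_act = 'Z(G) :&: xker a.
Proof.
have ellV s : ell a s^-1 = (ell a s)^-1.
  by apply: (mulIg (ell a s)); rewrite -ellM mulgV ell1 mulVg.
apply/setP=> s; have Gs : s \in G by rewrite inE.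
apply/(kerP opp_act_morphism Gs)/setIP
  => /= [[e1 e2] | [/setIP[_ /centP Cs] /xker1 e]].
  split; last by rewrite inE -invg_eq1 -ellV; apply/eqP.
  rewrite inE Gs; apply/centP=> y _; apply/commute_sym/commgP/conjg_fixP.
  by rewrite -conj_autT e1 perm1.
rewrite /opp_act ellV e invg1; congr (_, _); apply/permP=> y.
by rewrite conj_autT perm1 conjgE -Cs ?inE // mulKg.
Qed.

Lemma restr_conj_aut s : restr G (conj_aut G s) = cj G s^-1.
Proof.
by apply/ffunP=> x; rewrite !ffunE inE conj_autT conjgE invgK mulgA.
Qed.

Lemma im_opp_act : opp_act @* G = autpair G (Aut_SX a G).
Proof.
apply/setP=> w; rewrite [RHS]inE; apply/morphimP/andP.
  case=> s _ _ ->; rewrite Aut_aut restr_conj_aut; split=> //.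
  by apply/imsetP; exists s^-1; rewrite //= groupV (subsetP (normG _)) ?inE.
case=> [_ /imsetP[s _ [e1 e2]]].
exists s^-1; rewrite ?inE // [w]surjective_pairing /= /opp_act invgK e2.
congr (_, _); apply/permP=> x; have /ffunP/(_ x) := e1.
by rewrite !ffunE inE conj_autT conjgE invgK mulgA.
Qed.

Lemma autpair_group_set : group_set (autpair G (XX G G)).
Proof.
apply/group_setP; split.
  rewrite inE group1 /=.
  have -> : restr G (1 : {perm S}) = idf G.
    by apply/ffunP=> x; rewrite !ffunE perm1.
  exact: fas_id.
move=> v w /setIdP[Av vX] /setIdP[Aw wX].
apply/setIdP; split; first exact: groupM.
have := fas_comp vX wX; rewrite /pair_comp /=.
suff -> : fcomp (restr G w.1) (restr G v.1) = restr G (v * w).1 by [].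
by apply/ffunP=> x; rewrite !ffunE !inE permM.
Qed.

Lemma card_autpair : #|autpair G (XX G G)| = #|XX G G|.
Proof.
pose h (w : {perm S} * {perm X}) := (restr G w.1, w.2).
have hinj : injective h.
  move=> [u s] [v t] [/ffunP e ->]; congr (_, _); apply/permP=> x.
  by have := e x; rewrite !ffunE !inE.
rewrite -(card_imset _ hinj); apply: eq_card => u.
apply/imsetP/idP => [[w + ->] | uX]; first by rewrite inE => /andP[].
have [uM ui _ _] := InjP _ _ _ (fas_Inj uX).
have uinj : injective u.1 by move=> x y; apply: ui; rewrite inE.
have rE : restr G (perm uinj) = u.1.
  by apply/ffunP=> x; rewrite ffunE inE permE.
exists (perm uinj, u.2); last by rewrite /h /= rE -surjective_pairing.
rewrite inE /= rE -surjective_pairing uX andbT inE; apply/andP; split.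
  by apply/subsetP=> x _; rewrite inE.
by apply/morphicP=> x y Gx Gy; rewrite !permE uM.
Qed.

Lemma autpair_index p : p.-Sylow(autpair G (XX G G)) (autpair G (Aut_SX a G)) ->
  exists2 k, p^'.-nat k & (#|XX G G| * #|'Z(G) :&: xker a|)%N = (k * #|S|)%N.
Proof.
rewrite -im_opp_act -card_autpair => /and3P[sBA _ pk].
exists #|autpair G (XX G G) : opp_act @* G| => //.
have <- : (#|'ker opp_act| * #|opp_act @* G|)%N = #|S|.
  by rewrite card_morphim setIid -cardsT (Lagrange (subsetT ('ker opp_act))).
have <- := LagrangeI (Group autpair_group_set) (opp_act @* G).
by rewrite (setIidPr sBA) -ker_opp_act mulnAC mulnC mulnA mulnAC mulnA.
Qed.

End Top.

Section LinkSylow.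
Variables (S : finGroupType) (X : finType) (a : left_action S X).
Variable XX : fusion_action_system a.
Local Notation H := (xcentrics XX).
Variables (L : category (ob H)).
Variables (delta : functor (trcat H) L) (pi : functor L (fascat H XX)).
Hypothesis lk : linking_action_system delta pi.
Local Notation topS := (topS XX).
Local Notation G := [set: S]%G.
Local Notation hat := (hat delta).

Lemma setT_fully_normalized : fully_normalized XX G.
Proof.
move=> Q _; apply/subset_leq_card/subsetP => x _.
by rewrite (subsetP (normG _)) ?inE.
Qed.

(** L(S) is in bijection with X(S) x Z(S;X): choose a lift of every element of
    X(S) and let Z(S;X) act on the fibres of pi. *)
Lemma link_End_enum :
  exists f : {u | u \in XX G G} * {z | z \in ZPX topS} -> L topS topS,
  injective f /\ forall g, exists x, f x = g.
Proof.
have [s sP] : exists s : fashom XX topS topS -> L topS topS,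
    forall u, pi _ _ (s u) = u.
  have /fin_all_exists[s sP] := @lk_pi_surj _ _ _ _ _ _ _ lk topS topS.
  by exists s.
pose f (x : {u | u \in XX G G} * {z | z \in ZPX topS}) : L topS topS :=
  compc (s x.1) (hat (ZPX_in (svalP x.2))).
have fE x : pi _ _ (f x) = x.1.
  apply: etrans (sP _); apply/esym/(lk_orbit lk).
  by exists (sval x.2), (svalP x.2).
exists f; split=> [x y exy | g].
  have e1 : x.1 = y.1.
    exact: etrans (esym (fE x)) (etrans (congr1 (pi _ _) exy) (fE y)).
  rewrite [x]surjective_pairing [y]surjective_pairing e1; congr (_, _).
  move: exy; rewrite /f e1 => /(link_mono lk)/(lk_delta_inj lk).
  by move/(congr1 sval) => /= e2; apply: val_inj.
have /(lk_orbit lk)[z [Zz ->]] : pi _ _ (s (pi _ _ g)) = pi _ _ g by rewrite sP.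
exists (pi _ _ g, exist _ z Zz); rewrite /f; congr (compc _ _); exact: delta_eq.
Qed.

Lemma link_Sylow (p : nat) : p.-group [set: S] -> saturated p XX ->
  Sylow_end p (fun g : L topS topS => exists s, g = delta topS topS s).
Proof.
move=> pS sat.
have [_ /autpair_index[k p'k kE] _] := sat2 sat setT_fully_normalized.
have [f [finj fsurj]] := link_End_enum.
have [K [h [hbij h1 hM cardK]]] :=
  end_group finj fsurj (@link_endo_iso _ _ _ _ _ _ _ lk topS).
have [hi hK hiK] := hbij.
pose dS s : L topS topS := hat (in_setT s : s \in topS).
pose j s := hi (dS s).
have jM : {in G &, {morph j : s t / s * t}}.
  move=> s t _ _; apply: (can_inj hK); rewrite hM !hiK.
  exact/esym/delta_comp.
have jinj : injective j.
  by move=> s t /(can_inj hiK)/(lk_delta_inj lk)/(congr1 sval).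
pose jm := Morphism jM.
have cB : #|jm @* G| = #|S|.
  by rewrite card_injm ?cardsT //; apply/injmP=> s t _ _ /jinj.
exists K, (jm @* G)%G, h; split=> //.
  move=> x; split=> [/morphimP[s _ _ ->] | [[s Ps] e]].
    by eexists; rewrite /= hiK; reflexivity.
  apply/morphimP; exists s; rewrite ?inE //=; apply: (can_inj hK).
  by rewrite hiK e; apply: delta_eq.
apply/and3P; split; [exact: subsetT | exact: morphim_pgroup |].
suff -> : #|[set: K] : jm @* G| = k by [].
apply/eqP; rewrite -(eqn_pmul2l (cardG_gt0 (jm @* G)%G)) (Lagrange (subsetT _)).
by rewrite /= cB [eqbRHS]mulnC -kE cardsT cardK card_prod !card_sig.
Qed.

End LinkSylow.

Theorem corollary3p4p5 (S : finGroupType) (X : finType) (p : nat)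
    (a : left_action S X) (XX : fusion_action_system a)
    (L : category (ob (xcentrics XX)))
    (delta : functor (trcat (xcentrics XX)) L)
    (pi : functor L (fascat (xcentrics XX) XX)) :
  prime p -> (p.-group [set: S])%g ->
  saturated p XX ->
  linking_action_system delta pi ->
  transporter_system p delta (compF (forget (xcentrics XX) XX) pi).
Proof.
move=> _ pS sat lk.
have kerE (P : ob (xcentrics XX)) (e : L P P) :
    tker (compF (forget (xcentrics XX) XX) pi) e -> (sval (pi _ _ e)).1 = idf P.
  by move/(congr1 sval).
split.
- by move=> P Q; apply: xcentric_conj.
- by move=> P Q; apply: xcentric_over.
- by move=> P e _; exact (link_endo_iso lk e).
- by move=> P Q g e _; rewrite -[RHS]comp1r => /(link_mono lk).
- by move=> P Q g e /kerE; apply: (link_freel lk).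
- move=> P Q [f /= fX]; have /imsetP[u uX fE] := fX.
  have [g gE] := pr_surj lk uX; exists g; apply: val_inj.
  by rewrite /= gE fE.
- move=> P Q g h; split=> [e12 | [e eK ->]].
    have [e e1 ->] := link_faithful lk (congr1 sval e12).
    by exists e => //; apply: val_inj.
  by rewrite fmapM eK comp1r.
- exact: lk_delta_inj lk.
- by move=> P Q s; apply: (link_delta_conj lk).
- by move=> P Q g x Px; rewrite -(lk_C lk); congr (compc _ _); apply: delta_eq.
- by exists (topS XX) => //; apply: (link_Sylow lk).
move=> P Q P' Q' g g' nP nQ.
exact: (link_extend (untwisted_linking lk) (untwisted_delta lk) sat).
Qed.
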